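(* For every integer $d\ge2$ there exists a real polynomial $P(t)=a_dt^d+\dots+a_2t^2$ of degree $d$ without linear term such that, whenever $p_1,p_2>1$ are real numbers, $\frac1r=\frac1{p_1}+\frac1{p_2}$ and $r<\frac{d-1}{d}$, neither $H_{\Gamma_P}$ nor $M_{\Gamma_P}$ is bounded from $L^{p_1}(\mathbb R)\times L^{p_2}(\mathbb R)$ to $L^r(\mathbb R)$.
   Context: For Schwartz functions $f,g$ on $\mathbb R$, $$H_{\Gamma_P}(f,g)(x)=\mathrm{p.v.}\int_{\mathbb R} f(x-t)\,g(x-P(t))\,\frac{dt}{t},\qquad M_{\Gamma_P}(f,g)(x)=\sup_{\epsilon>0}\frac1{2\epsilon}\int_{-\epsilon}^{\epsilon}|f(x-t)\,g(x-P(t))|\,dt .$$ Such an operator $B$ is bounded from $L^{p_1}\times L^{p_2}$ to $L^r$ if there is a constant $C$ with $\|B(f,g)\|_r\le C\|f\|_{p_1}\|g\|_{p_2}$ for all Schwartz functions $f,g$. *)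

(* Defs.v *)
From HB Require Import structures.
From mathcomp Require Import all_boot all_order all_algebra.
From mathcomp Require Import complex.
From mathcomp Require Import all_classical all_reals all_analysis.

Set Implicit Arguments.
Unset Strict Implicit.
Unset Printing Implicit Defensive.

Import Order.TTheory GRing.Theory Num.Theory.
Import numFieldNormedType.Exports.

Local Open Scope classical_set_scope.
Local Open Scope ring_scope.

Section defs.
Context {R : realType}.
Local Notation C := R[i].
Local Notation mu := (@lebesgue_measure R).
Implicit Types (f g h : R -> C) (P : {poly R}).

Definition re_part h : R -> R := fun x => complex.Re (h x).
Definition im_part h : R -> R := fun x => complex.Im (h x).

(* The real modulus: `|z| on R[i] has values in R[i]. *)
Definition modulus (z : C) : R := ComplexField.Normc.normc z.

(* R[i] is not a normed module over R in the library, so differentiation and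
   integration of complex-valued functions of a real variable are defined on
   real and imaginary parts. *)
Definition smooth h : Prop :=
  forall (n : nat) (x : R),
    derivable (derive1n n (re_part h)) x 1 /\ derivable (derive1n n (im_part h)) x 1.

Definition cderive (n : nat) h : R -> C :=
  fun x => Complex (derive1n n (re_part h) x) (derive1n n (im_part h) x).

Definition cintegral (A : set R) h : C :=
  Complex (\int[mu]_(t in A) re_part h t) (\int[mu]_(t in A) im_part h t).

Definition schwartz f : Prop :=
  smooth f /\
  forall m n : nat, exists K : R,
    forall x : R, `|x| ^+ m * modulus (cderive n f x) <= K.

Definition truncated_hilbert P f g (x e : R) : C :=
  cintegral [set t | e < `|t|]
    (fun t => f (x - t) * g (x - P.[t]) * real_complex R t^-1).

(* The principal value is the limit of the truncations as e tends to 0 from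
   the right, again taken on real and imaginary parts; it exists for Schwartz
   f and g. *)
Definition hilbert P f g : R -> C := fun x =>
  Complex (lim (complex.Re (truncated_hilbert P f g x e) @[e --> 0^'+]))
          (lim (complex.Im (truncated_hilbert P f g x e) @[e --> 0^'+])).

Definition maximal P f g : R -> \bar R := fun x =>
  ereal_sup [set ((2 * e)^-1%:E *
      \int[mu]_(t in `[(- e)%R, e]) (modulus (f (x - t) * g (x - P.[t])))%:E)%E
    | e in [set e : R | 0 < e]].

Definition emodulus h : R -> \bar R := fun x => (modulus (h x))%:E.

(* Only the modulus of B(f,g) matters for its L^r norm, so B has values in
   the extended reals; for an operator with complex values, compose with
   emodulus. *)
Definition bounded_Lp (B : (R -> C) -> (R -> C) -> (R -> \bar R))
    (p1 p2 r : R) : Prop :=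
  exists K : R, forall f g, schwartz f -> schwartz g ->
    ('N[mu]_(r%:E)[B f g] <=
       K%:E * 'N[mu]_(p1%:E)[emodulus f] * 'N[mu]_(p2%:E)[emodulus g])%E.

Definition hilbert_bounded P (p1 p2 r : R) : Prop :=
  bounded_Lp (fun f g => emodulus (hilbert P f g)) p1 p2 r.

Definition maximal_bounded P (p1 p2 r : R) : Prop :=
  bounded_Lp (maximal P) p1 p2 r.

End defs.

(* Main.v *)
Require Import Defs.
From mathcomp Require Import all_boot all_order all_algebra.
From mathcomp Require Import complex ring lra.
From mathcomp Require Import all_classical all_reals all_analysis.

Import Order.TTheory GRing.Theory Num.Theory.
Import numFieldNormedType.Exports.
Local Open Scope ring_scope.

(** Take [P(t) = t - (1 - (1 - t)^d) / d], so that [t - P(t)] is constant to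
    order [d] at [t = 1] while [P] has no linear term at [0].  Let [f], [g] be
    bumps of width [delta = 4 s^d] centered at [0] and [1/d].  If
    [|x - 1| <= s / 2] and [|x - t| <= s^d], then
    [x - P(t) - 1/d = (x - t) - (1 - t)^d / d] is at most [2 s^d] in modulus, so
    both operators are at least of order [s^d] on an interval of length [s]
    around [1], and their [L^r] norm is at least of order [s^(d + 1/r)].  The
    product of the norms of [f] and [g] is of order [s^(d/r)], and
    [d/r > d + 1/r] as soon as [r < (d - 1) / d]; let [s] tend to [0]. *)

(** * Smoothness of the standard bump *)

Section bump.
Context {R : realType}.
Implicit Types (p : {poly R}) (m : nat) (x y k a : R).

(* The functions [p(x) u^m exp(-u)], [u = 1 / (1 - x^2)], extended by 0 outside
   ]-1, 1[: a family of smooth functions closed under derivation. *)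
Definition bump_term p m x : R :=
  if `|x| < 1 then p.[x] * (1 - x ^+ 2)^-1 ^+ m * expR (- (1 - x ^+ 2)^-1)
  else 0.

(** As u' = 2 x u^2, the derivative of p u^m exp(-u) is (p' + 2 m x p u - 2 x p u^2) u^m exp(-u).
    Factoring out u^(m+2), with u^-1 = 1 - x^2, leaves this polynomial. *)
Definition bump_step p m : {poly R} :=
  p^`() * (1 - 'X^2) ^+ 2 + (2 * m)%:R *: ('X * p * (1 - 'X^2)) - 2%:R *: ('X * p).

Lemma one_minus_sqr_gt0 x : `|x| < 1 -> 0 < 1 - x ^+ 2.
Proof.
by move=> x1; rewrite subr_gt0 -real_normK ?num_real// expr_lt1.
Qed.

Lemma is_derive_bump_term_interior p m x : `|x| < 1 ->
  is_derive x 1 (bump_term p m) (bump_term (bump_step p m) m.+2 x).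
Proof.
move=> x1; have v0 := one_minus_sqr_gt0 x x1.
have vN0 : 1 - x ^+ 2 != 0 by rewrite gt_eqF.
set u := fun y : R => (1 - y ^+ 2)^-1.
have du : is_derive x 1 u (2 * x * u x ^+ 2).
  have dv : is_derive x 1 (fun y : R => 1 - y ^+ 2) (- (2 * x)).
    rewrite (_ : (fun y : R => _) = horner (1 - 'X^2)); last first.
      by apply/funext => y; rewrite !hornerE.
    by apply: is_derive_eq; rewrite derivB derivXn -polyC1 derivC !hornerE; ring.
  apply: (is_derive_eq (is_deriveV (f := fun y : R => 1 - y ^+ 2) vN0 dv)).
  by rewrite /u /GRing.scale/= exprVn; ring.
have de : is_derive x 1 (fun y : R => expR (- u y)) (expR (- u x) * - (2 * x * u x ^+ 2)).
  apply: (is_derive1_comp (f := expR) (g := - u)); exact: is_deriveN.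
have dpow : is_derive x 1 (fun y : R => u y ^+ m) (m%:R * u x ^+ m.+1 * (2 * x)).
  rewrite (_ : (fun y : R => _) = u ^+ m); last by apply/funext => y; rewrite !fctE.
  apply: (is_derive_eq (is_deriveX m du)).
  by case: m => [|m]; rewrite /GRing.scale/= ?mul0r// !exprS; ring.
have D : is_derive x 1 (fun y : R => p.[y] * u y ^+ m * expR (- u y))
    (p.[x] * u x ^+ m * (expR (- u x) * - (2 * x * u x ^+ 2)) +
     expR (- u x) * (p.[x] * (m%:R * u x ^+ m.+1 * (2 * x)) + u x ^+ m * p^`().[x])).
  exact: is_deriveM (is_deriveM (is_derive_poly p x) dpow) de.
apply: (@near_eq_is_derive _ _ _ _ _ _ _ _ _ (is_derive_eq D _)).
  have : \forall y \near x, `|y| < 1.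
    by apply: (@cvgr_norm_lt R R R (nbhs x) _ id x _ 1 x1); exact: cvg_id.
  by apply: filterS => y y1; rewrite /bump_term y1.
rewrite /bump_term x1 -/(u x).
have -> : u x ^+ m.+2 = u x ^+ m * u x ^+ 2 by rewrite -exprD addn2.
rewrite (exprS _ m) /bump_step !hornerE natrM.
have -> : 1 - x ^+ 2 = (u x)^-1 by rewrite invrK.
have uN0 : u x != 0 by rewrite /u invr_eq0.
by move: (expR (- u x)) (u x ^+ m) => E U; move: (u x) uN0 => v vN /=; field.
Qed.

(* The quadratic decay makes the derivative vanish at every point outside
   ]-1, 1[, including the endpoints. *)
Lemma bump_term_bound p m : exists2 K : R, 0 <= K &
  forall x x0, 1 <= `|x0| -> `|bump_term p m x| <= K * `|x - x0| ^+ 2.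
Proof.
pose S : R := \sum_(i < size p) `|p`_i|.
have S0 : 0 <= S by apply: sumr_ge0.
(* [S] bounds |p| on [-1, 1]; the factorial comes from u^(m+2) / (m+2)! <= exp(u), hence u^m exp(-u)
   <= (m+2)! (1 - x^2)^2; the 4 comes from 1 - x^2 <= 2 (1 - |x|) <= 2 |x - x0|. *)
exists (S * (m.+2)`!%:R * 4); first by rewrite !mulr_ge0.
move=> x x0 x01; rewrite /bump_term; case: ifPn => x1; last first.
  by rewrite normr0 !mulr_ge0// exprn_ge0.
have v0 := one_minus_sqr_gt0 x x1.
set v := 1 - x ^+ 2 in v0 *.
have pS : `|p.[x]| <= S.
  rewrite horner_coef (le_trans (ler_norm_sum _ _ _))// ler_sum// => i _.
  by rewrite normrM ler_piMr// normrX exprn_ile1// ltW.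
have uE : v^-1 ^+ m * expR (- v^-1) <= (m.+2)`!%:R * v ^+ 2.
  have := expR_ge1Dxn m.+1 (ltW (_ : 0 < v^-1)); rewrite invr_gt0 => /(_ v0) H.
  rewrite expRN ler_pdivrMr ?expR_gt0//.
  have -> : v^-1 ^+ m = v ^+ 2 * v^-1 ^+ m.+2.
    by rewrite !exprS; field; rewrite gt_eqF.
  rewrite [leRHS]mulrAC [leRHS]mulrC ler_pM2l ?exprn_gt0//.
  rewrite -ler_pdivrMl ?ltr0n ?fact_gt0// mulrC.
  by apply: le_trans H; rewrite lerDr.
have vx : v <= 2 * `|x - x0|.
  have n1 : 1 - `|x| <= `|x - x0|.
    have : `|x0| <= `|x| + `|x - x0|.
      by rewrite -[X in `|X| <= _](subKr x x0); exact: ler_normB.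
    by lra.
  rewrite /v -(real_normK (num_real x)).
  have := normr_ge0 x; nra.
have U0 : 0 <= v^-1 ^+ m * expR (- v^-1).
  by rewrite mulr_ge0 ?expR_ge0 ?exprn_ge0// invr_ge0 ltW.
rewrite -[X in `|X|]mulrA normrM (ger0_norm U0) -!mulrA ler_pM//.
apply: (le_trans uE); rewrite ler_pM2l ?ltr0n ?fact_gt0//.
have -> : 4 * `|x - x0| ^+ 2 = (2 * `|x - x0|) ^+ 2 by ring.
by rewrite lerXn2r ?nnegrE ?mulr_ge0// ltW.
Qed.

Lemma is_derive_bump_term p m x :
  is_derive x 1 (bump_term p m) (bump_term (bump_step p m) m.+2 x).
Proof.
have [|x1] := ltP `|x| 1; first exact: is_derive_bump_term_interior.
have z0 q l : bump_term q l x = 0 by rewrite /bump_term ltNge x1.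
rewrite z0; apply/is_derive1_caratheodory.
(* This slope is 0 at [x], division by zero being zero, and is continuous there because it is at
   most K |z - x| in modulus. *)
exists (fun z => bump_term p m z / (z - x)); split; last by rewrite z0 mul0r.
  move=> z; rewrite z0 subr0; have [->|zx] := eqVneq z x.
    by rewrite z0 !mul0r.
  by rewrite divfK// subr_eq0.
have [K K0 HK] := bump_term_bound p m.
rewrite /prop_for /continuous_at /= z0 mul0r.
apply/cvgr0Pnorm_le => e e0.
have K1 : 0 < K + 1 by rewrite ltr_wpDl.
have eK : 0 < e / (K + 1) by exact: divr_gt0.
near=> z.
have [->|zx] := eqVneq z x; first by rewrite subrr invr0 mulr0 normr0 ltW.
have zx0 : 0 < `|z - x| by rewrite normr_gt0 subr_eq0.
rewrite normrM normfV ler_pdivrMr//.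
apply: (le_trans (HK z x x1)); rewrite expr2 mulrA ler_pM2r//.
have : `|z - x| < e / (K + 1).
  near: z.
  have := nbhsx_ballx x _ eK; apply: filterS => y.
  by rewrite /ball/= distrC.
rewrite ltr_pdivlMr//; nra.
Unshelve. all: by end_near. Qed.

End bump.

(** * Translated and rescaled bumps as Schwartz functions *)

Section scaled_bump.
Context {R : realType}.
Implicit Types (p : {poly R}) (m n : nat) (x y k a w : R).

Lemma is_derive_affine k a x : is_derive x 1 (fun y : R => k * (y - a)) k.
Proof.
rewrite (_ : (fun y : R => _) = horner (k *: ('X - a%:P))); last first.
  by apply/funext => y; rewrite !hornerE.
by apply: is_derive_eq; rewrite derivZ derivB derivX derivC subr0 !hornerE.
Qed.

(** The chain rule factor [k] is absorbed into the polynomial, so the family remains closed under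
    derivation after an affine change of variable. *)
Lemma derive1n_bump_term k a n p m : exists q l,
  derive1n n (fun x => bump_term p m (k * (x - a))) =
  (fun x => bump_term q l (k * (x - a))).
Proof.
elim: n p m => [|n IH] p m; first by exists p, m.
rewrite derive1Sn.
suff -> : derive1 (fun x => bump_term p m (k * (x - a))) =
    (fun x => bump_term (k *: bump_step p m) m.+2 (k * (x - a))) by [].
apply/funext => x; rewrite derive1E; apply: derive_val.
apply: (is_derive_eq (is_derive1_comp (is_derive_bump_term p m _) (is_derive_affine k a x))).
rewrite /bump_term; case: ifP => _; last by rewrite mul0r.
by rewrite hornerZ; ring.
Qed.

Lemma derivable_bump_term k a p m x :
  derivable (fun x => bump_term p m (k * (x - a))) x 1.
Proof.
by have [] := is_derive1_comp (is_derive_bump_term p m _) (is_derive_affine k a x).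
Qed.

(** For w > 0, the standard bump exp(-1 / (1 - y^2)), y = (x - a) / w, supported on
    [a - w, a + w]. *)
Definition rbump a w x : R := bump_term 1 0 (w^-1 * (x - a)).

Definition cbump a w x : R[i] := real_complex R (rbump a w x).

Lemma rbump_eq0 a w x : 0 < w -> w <= `|x - a| -> rbump a w x = 0.
Proof.
move=> w0 wx; rewrite /rbump /bump_term ifN// -leNgt normrM gtr0_norm ?invr_gt0//.
by rewrite mulrC ler_pdivlMr// mul1r.
Qed.

Lemma rbump_ge0 a w x : 0 <= rbump a w x.
Proof.
rewrite /rbump /bump_term; case: ifP => // _.
by rewrite hornerC expr0 !mul1r expR_ge0.
Qed.

Lemma rbump_le1 a w x : rbump a w x <= 1.
Proof.
rewrite /rbump /bump_term; case: ifP => // x1.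
by rewrite hornerC expr0 !mul1r expR_le1 oppr_le0 invr_ge0 ltW// one_minus_sqr_gt0.
Qed.

(** Here |y| <= 1/2, so 1 - y^2 >= 1/2 and the exponent is at least -2. *)
Lemma rbump_ge a w x : 0 < w -> `|x - a| <= w / 2 -> expR (- 2) <= rbump a w x.
Proof.
move=> w0 xw; rewrite /rbump /bump_term.
set y := w^-1 * (x - a).
have y1 : `|y| <= 2^-1.
  by rewrite /y normrM gtr0_norm ?invr_gt0// mulrC ler_pdivrMr// mulrC.
rewrite ifT; last by lra.
rewrite hornerC expr0 !mul1r ler_expR lerN2.
have y2 : 2^-1 <= 1 - y ^+ 2.
  by rewrite -(real_normK (num_real y)); have := normr_ge0 y; nra.
by rewrite -[leRHS]invrK lef_pV2// posrE; lra.
Qed.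

Lemma derive1n_cst0 n : derive1n n (fun=> 0 : R) = fun=> 0.
Proof.
elim: n => // n IH; rewrite derive1nS IH; apply/funext => x.
exact: derive1_cst.
Qed.

Lemma modulus_real y : modulus (real_complex R y) = `|y|.
Proof. by rewrite /modulus /= expr0n/= addr0 sqrtr_sqr. Qed.

Lemma schwartz_cbump a w : 0 < w -> schwartz (cbump a w).
Proof.
move=> w0; split=> [n x|m n].
  rewrite /re_part /im_part /=; split.
    have [q [l H]] := derive1n_bump_term w^-1 a n 1 0.
    by rewrite [derive1n _ _]H; exact: derivable_bump_term.
  by rewrite [derive1n _ _]derive1n_cst0; exact: derivable_cst.
have [q [l H]] := derive1n_bump_term w^-1 a n 1 0.
have [K K0 HK] := bump_term_bound q l.
(* On the support |x| <= |a| + w. The quadratic bound, taken at x0 = 1, serves as a uniform bound: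
   |y - 1|^2 <= 4 when |y| < 1. *)
exists ((`|a| + w) ^+ m * (K * 4)) => x.
rewrite /cderive [derive1n _ (im_part _)]derive1n_cst0 [derive1n _ _]H.
rewrite -[Complex _ _]/(real_complex R _) modulus_real.
have [x1|x1] := ltP `|w^-1 * (x - a)| 1; last first.
  rewrite /bump_term ifN -?leNgt// normr0 mulr0.
  by rewrite !mulr_ge0// exprn_ge0// addr_ge0// ltW.
have xaw : `|x| <= `|a| + w.
  have : `|x - a| <= w.
    move: x1; rewrite normrM gtr0_norm ?invr_gt0// mulrC ltr_pdivrMr// mul1r.
    exact: ltW.
  have : `|x| <= `|a| + `|x - a|.
    by rewrite -[X in `|X| <= _](subrKC a); exact: ler_normD.
  lra.
apply: ler_pM => //.
  by rewrite lerXn2r// nnegrE// addr_ge0// ltW.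
apply: (le_trans (HK _ 1 _)); first by rewrite normr1.
rewrite ler_wpM2l// (_ : 4 = 2 ^+ 2); last by ring.
rewrite lerXn2r ?nnegrE//.
by apply: (le_trans (ler_normB _ _)); rewrite normr1; lra.
Qed.

End scaled_bump.

(** * Integrals and L^p norms compared with constants on a set *)

Section integral_bounds.
Import HBNNSimple.
Local Open Scope classical_set_scope.
Local Open Scope ereal_scope.
Context {d : measure_display} {T : measurableType d} {R : realType}.
Context (mu : {measure set T -> \bar R}).
Implicit Types (D A : set T) (f g : T -> \bar R).

(* Unlike ge0_le_integral, no measurability is required: the integral of a
   nonnegative function is a supremum over the simple functions below it. *)
Lemma ge0_le_integral_patch D A f g :
  (forall x, D x -> 0 <= f x) -> (forall x, A x -> 0 <= g x) ->
  (forall x, (f \_ D) x <= (g \_ A) x) ->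
  \int[mu]_(x in D) f x <= \int[mu]_(x in A) g x.
Proof.
move=> f0 g0 fg; rewrite (ge0_integralE mu f0) (ge0_integralE mu g0).
apply: ereal_sup_le => _ [h /= hf <-].
exists h => //= x.
exact: le_trans (hf x) (fg x).
Qed.

Lemma integral_ge_on D A f (c : R) : measurable A -> A `<=` D ->
  (0 <= c)%R -> (forall x, D x -> 0 <= f x) -> (forall x, A x -> c%:E <= f x) ->
  c%:E * mu A <= \int[mu]_(x in D) f x.
Proof.
move=> mA AD c0 f0 cf; rewrite -(integral_cst mu mA c%:E).
apply: ge0_le_integral_patch => // x.
rewrite /patch; case: ifPn => xA; case: ifPn => xD //.
- by apply: cf; exact: set_mem.
- by case/negP: xD; apply/mem_set/AD/set_mem.
- by apply: f0; exact: set_mem.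
Qed.

Lemma integral_le_on D A f (c : R) : measurable A ->
  (0 <= c)%R -> (forall x, D x -> 0 <= f x) -> (forall x, f x <= c%:E) ->
  (forall x, ~ A x -> f x = 0) ->
  \int[mu]_(x in D) f x <= c%:E * mu A.
Proof.
move=> mA c0 f0 fc fA; rewrite -(integral_cst mu mA c%:E).
apply: ge0_le_integral_patch => // x.
rewrite /patch; case: ifPn => xD; case: ifPn => xA //.
by rewrite fA// => /mem_set; apply/negP.
Qed.

(** Chebyshev's argument: |f|^r dominates c^r on [A]. It is applied with r < 1. *)
Lemma Lnorm_ge_on A f (c v r : R) : measurable A -> mu A = v%:E ->
  (0 < r)%R -> (0 <= c)%R -> (forall x, A x -> c%:E <= `|f x|) ->
  (c * v `^ r^-1)%:E <= 'N[mu]_(r%:E)[f].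
Proof.
move=> mA Av r0 c0 cf; rewrite unlock.
have v0 : (0 <= v)%R by rewrite -lee_fin -Av.
have -> : (c * v `^ r^-1)%:E = ((c `^ r)%:E * mu A) `^ r^-1.
  rewrite Av -EFinM poweR_EFin powRM ?powR_ge0// -powRrM mulfV ?gt_eqF//.
  by rewrite powRr1.
have H : (c `^ r)%:E * mu A <= \int[mu]_x `|f x| `^ r.
  apply: integral_ge_on => // [|x _|x Ax]; rewrite ?powR_ge0 ?poweR_ge0//.
  by rewrite -poweR_EFin gt0_ler_poweR ?(ltW r0)// ?cf// in_itv/= leey andbT ?lee_fin.
apply: gt0_ler_poweR; rewrite ?invr_ge0 ?(ltW r0)// in_itv/= leey andbT.
  by rewrite Av -EFinM lee_fin mulr_ge0 ?powR_ge0.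
by apply: le_trans H; rewrite Av -EFinM lee_fin mulr_ge0 ?powR_ge0.
Qed.

Lemma Lnorm_le_on A f (v p : R) : measurable A -> mu A = v%:E ->
  (0 < p)%R -> (forall x, `|f x| <= 1) -> (forall x, ~ A x -> f x = 0) ->
  'N[mu]_(p%:E)[f] <= (v `^ p^-1)%:E.
Proof.
move=> mA Av p0 f1 fA; rewrite unlock.
have -> : (v `^ p^-1)%:E = (1%:E * mu A) `^ p^-1 by rewrite mul1e Av.
have i0 : 0 <= \int[mu]_x `|f x| `^ p.
  by apply: integral_ge0 => x _; exact: poweR_ge0.
have H : \int[mu]_x `|f x| `^ p <= 1%:E * mu A.
  apply: integral_le_on => // [x _|x|x /fA ->]; first exact: poweR_ge0.
    by rewrite -[leRHS](poweR1r p) gt0_ler_poweR ?(ltW p0)// in_itv/= leey andbT.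
  by rewrite abse0 poweR0r// gt_eqF.
by apply: gt0_ler_poweR; rewrite ?invr_ge0 ?(ltW p0)// in_itv/= leey andbT.
Qed.

End integral_bounds.

(** * Pointwise lower bounds for the two operators *)

Section operator_bounds.
Context {R : realType}.
Local Notation mu := (@lebesgue_measure R).
Local Open Scope classical_set_scope.
Implicit Types (P : {poly R}) (F G : R -> R).

Lemma lebesgue_measure_centered (x w : R) : 0 <= w ->
  mu `[x - w, x + w] = (2 * w)%:E.
Proof.
move=> w0; rewrite lebesgue_measure_itv/= lte_fin.
case: ltP => [_|xw]; first by rewrite -EFinB; congr (_%:E); ring.
by congr (_%:E); lra.
Qed.

Lemma in_centered (x w t : R) : `[x - w, x + w] t <-> `|x - t| <= w.
Proof. by rewrite /= in_itv/= distrC ler_distl. Qed.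

Lemma modulus_realM (a b : R) :
  modulus (real_complex R a * real_complex R b) = `|a * b|.
Proof. by rewrite -(rmorphM (real_complex R)) modulus_real. Qed.

Lemma maximal_ge P F G (x c w : R) : 0 <= c -> 0 <= w ->
  -2 <= x - w -> x + w <= 2 ->
  (forall t, `|x - t| <= w -> c <= F (x - t) * G (x - P.[t])) ->
  ((c * w / 2)%:E <=
    maximal P (fun y => real_complex R (F y)) (fun y => real_complex R (G y)) x)%E.
Proof.
move=> c0 w0 xw1 xw2 cFG.
(* The scale e = 2 is taken because [-2, 2] contains [x - w, x + w]; the average is then at least
   (1/4) c (2 w). *)
apply: le_trans (ereal_sup_ubound _); last first.
  by exists 2 => //=.
have -> : c * w / 2 = (2 * 2)^-1 * (c * (2 * w)) by field.
rewrite EFinM lee_wpmul2l ?lee_fin// EFinM -(lebesgue_measure_centered x)//.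
apply: integral_ge_on => //.
- by move=> t /=; rewrite !in_itv/= => /andP[t1 t2]; apply/andP; split; lra.
- move=> t /in_centered/cFG h; rewrite lee_fin.
  suff : c <= modulus (real_complex R (F (x - t)) * real_complex R (G (x - P.[t]))) by [].
  by rewrite modulus_realM (le_trans h)// ler_norm.
Qed.

(* The support of F keeps t away from 0, so the truncated integrals are
   constant for e < 1/2. *)
Lemma emodulus_hilbert_ge P F G (x c w : R) : 0 <= c -> 0 <= w -> x + w <= 2 ->
  (forall y, 0 <= F y <= 1) -> (forall y, 0 <= G y <= 1) ->
  (forall t, t <= 1 / 2 -> F (x - t) = 0) -> (forall y, 1 < `|y| -> F y = 0) ->
  (forall t, `|x - t| <= w -> c <= F (x - t) * G (x - P.[t])) ->
  ((c * w)%:E <= emodulus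
    (hilbert P (fun y => real_complex R (F y)) (fun y => real_complex R (G y))) x)%E.
Proof.
move=> c0 w0 xw F01 G01 F0 Fs cFG.
pose h t := F (x - t) * G (x - P.[t]) * t^-1.
have h0 t : 0 <= h t.
  rewrite /h; have [t2|t2] := leP t (1 / 2); first by rewrite F0// !mul0r.
  have /andP[? _] := F01 (x - t); have /andP[? _] := G01 (x - P.[t]).
  by rewrite !mulr_ge0// invr_ge0; lra.
have h2 t : h t <= 2.
  rewrite /h; have [t2|t2] := leP t (1 / 2); first by rewrite F0// !mul0r.
  have /andP[? ?] := F01 (x - t); have /andP[? ?] := G01 (x - P.[t]).
  have t0 : 0 < t by lra.
  by rewrite ler_pdivrMr//; nra.
have hs t : ~ `[x - 1, x + 1] t -> h t = 0.
  by move=> /in_centered/negP; rewrite -ltNge /h => /Fs ->; rewrite !mul0r.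
pose I := (\int[mu]_t (h t)%:E)%E.
(* Finiteness matters because [fine] would send an infinite integral to 0. *)
have If : I \is a fin_num.
  rewrite ge0_fin_numE; last by apply: integral_ge0 => t _; rewrite lee_fin.
  have : (I <= 2%:E * mu `[(x - 1)%R, (x + 1)%R])%E.
    by apply: integral_le_on => // [t _|t /hs ->//]; rewrite lee_fin.
  move=> /le_lt_trans; apply.
  by rewrite lebesgue_measure_centered// -EFinM ltry.
(* On [x - w, x + w] one has t <= 2, so the kernel 1/t is at least 1/2, which offsets the length 2
   w. *)
have cI : ((c * w)%:E <= I)%E.
  have -> : (c * w)%:E = ((c / 2)%:E * mu `[(x - w)%R, (x + w)%R])%E.
    by rewrite lebesgue_measure_centered// -EFinM; congr (_%:E); field.
  apply: integral_ge_on => //; first by rewrite divr_ge0.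
    by move=> t _; rewrite lee_fin.
  move=> t /in_centered tc; rewrite lee_fin /h.
  have := cFG t tc; move: tc; rewrite ler_norml => /andP[tw _].
  (* For t <= 1/2 the factor [F] vanishes, which forces c <= 0. *)
  have [t2|t2] := leP t (1 / 2); first by rewrite F0// !mul0r; lra.
  have t0 : 0 < t by lra.
  by rewrite ler_pdivlMr//; nra.
have trunc e : e < 1 / 2 -> truncated_hilbert P (fun y => real_complex R (F y))
    (fun y => real_complex R (G y)) x e = real_complex R (fine I).
  move=> e2; rewrite /truncated_hilbert /cintegral /real_complex_def; congr Complex.
    congr fine; rewrite [LHS]integral_mkcond; apply: eq_integral => t _.
    rewrite /patch; case: ifPn => te.
      by rewrite /re_part /= !mul0r !mulr0 !subr0.
    rewrite /h F0 ?mul0r//.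
    have := ler_norm t; move: te; rewrite notin_setE/= => /negP; rewrite -leNgt; lra.
  rewrite /Rintegral (eq_integral (cst 0%E)) ?integral0// => t _.
  by rewrite /im_part /= !mul0r !mulr0 !addr0 mul0r addr0.
have near_e : \forall e \near (0 : R)^'+, e < 1 / 2 by exact: nbhs_right_lt.
have hilbertE : hilbert P (fun y => real_complex R (F y))
    (fun y => real_complex R (G y)) x = real_complex R (fine I).
  rewrite /hilbert /real_complex_def; congr Complex.
    by apply: lim_near_cst => //; apply: filterS near_e => e /trunc ->.
  by apply: lim_near_cst => //; apply: filterS near_e => e /trunc ->.
rewrite /emodulus hilbertE modulus_real (le_trans cI)// -(fineK If).
by rewrite lee_fin ler_norm.
Qed.

End operator_bounds.

(** * The polynomial and its contact with t - 1/d at t = 1 *)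

Section flat_poly.
Context {R : realType}.
Context (d : nat) (d2 : (2 <= d)%N).

Definition flat_poly : {poly R} := 'X - d%:R^-1 *: (1 - (1 - 'X) ^+ d).

Let d0 : (0 : R) < d%:R. Proof. by rewrite ltr0n (leq_trans _ d2). Qed.

Lemma horner_flat_poly t : flat_poly.[t] = t - d%:R^-1 * (1 - (1 - t) ^+ d).
Proof. by rewrite /flat_poly !hornerE. Qed.

(** The summand (1 - X)^d / d has degree d; the rest, X - 1/d, has degree 1 < d. *)
Lemma size_flat_poly : size flat_poly = d.+1.
Proof.
have -> : flat_poly = ((-1) ^+ d * d%:R^-1) *: ('X - 1%:P) ^+ d + ('X - d%:R^-1%:P).
  rewrite /flat_poly -[1 - 'X]opprB [(- ('X - 1)) ^+ d]exprNn.
  rewrite -!mul_polyC polyCM polyC_exp polyCN polyC1.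
  by ring.
have k0 : (-1) ^+ d * d%:R^-1 != 0 :> R.
  by rewrite mulf_neq0 ?signr_eq0 ?invr_eq0 ?gt_eqF.
by rewrite size_polyDl size_scale// size_exp_XsubC// size_XsubC.
Qed.

Lemma flat_poly_coef0 : flat_poly`_0 = 0.
Proof. by rewrite -horner_coef0 horner_flat_poly subr0 expr1n subrr mulr0 subrr. Qed.

(** This dictates the factor 1/d: 1 - (1 - t)^d has slope d at 0, so its multiple by 1/d cancels the
    slope of X. *)
Lemma flat_poly_coef1 : flat_poly`_1 = 0.
Proof.
have -> : flat_poly`_1 = flat_poly^`().[0] by rewrite horner_coef0 coef_deriv.
rewrite /flat_poly derivB derivX derivZ derivB deriv_exp derivB derivX.
rewrite -[1 in X in _ - _ *: X]polyC1 derivC !sub0r.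
rewrite mulNr mulNrn opprK mul1r hornerD hornerN hornerZ hornerMn horner_exp.
by rewrite !hornerE subr0 expr1n mulVf ?subrr// gt_eqF.
Qed.

Lemma flat_poly_near1 (s x t : R) : 0 < s -> s <= 1 / 8 ->
  `|x - 1| <= s / 2 -> `|x - t| <= s ^+ d ->
  `|x - flat_poly.[t] - d%:R^-1| <= 2 * s ^+ d.
Proof.
move=> s0 s8 x1 xt; have sd : s ^+ d <= s ^+ 2 by rewrite ler_wiXn2l//; lra.
(* Since d >= 2, s^d <= s^2 <= s/2, and the other half of s bounds |x - 1|. *)
have t1 : `|1 - t| <= s.
  have -> : 1 - t = (x - t) - (x - 1) by ring.
  apply: (le_trans (ler_normB _ _)).
  have : s ^+ 2 <= s / 2 by rewrite expr2; nra.
  lra.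
have -> : x - flat_poly.[t] - d%:R^-1 = (x - t) - d%:R^-1 * (1 - t) ^+ d.
  by rewrite horner_flat_poly; ring.
have -> : 2 * s ^+ d = s ^+ d + s ^+ d by ring.
apply: (le_trans (ler_normB _ _)); apply: lerD => //.
rewrite normrM normrX -[leRHS]mul1r ler_pM//.
  by rewrite normfV (ger0_norm (ltW d0)) invf_le1// ler1n (leq_trans _ d2).
by rewrite lerXn2r// nnegrE ltW.
Qed.

End flat_poly.

(** * The scaling argument *)

Section unboundedness.
Context {R : realType}.
Local Notation mu := (@lebesgue_measure R).
Local Open Scope classical_set_scope.

Lemma exists_powR_lt (c K theta : R) : 0 < c -> 0 <= K -> 0 < theta ->
  exists s : R, [/\ 0 < s, s <= 1 / 8 & K * s `^ theta < c].
Proof.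
move=> c0 K0 th0.
have e0 : 0 < c / (K + 1) by rewrite divr_gt0// ltr_wpDl.
have /cvgr0Pnorm_lt/(_ _ e0) H := powR_cvg0 th0.
near (0 : R)^'+ => s.
exists s; split; [by []|by near: s; exact: nbhs_right_le|].
have : `|s `^ theta| < c / (K + 1) by near: s.
rewrite ger0_norm ?powR_ge0// ltr_pdivlMr ?ltr_wpDl//.
have := powR_ge0 s theta; nra.
Unshelve. all: by end_near. Qed.

Lemma Lnorm_cbump_le (a w p : R) : 0 < w -> 0 < p ->
  ('N[mu]_(p%:E)[emodulus (cbump a w)] <= ((2 * w) `^ p^-1)%:E)%E.
Proof.
move=> w0 p0; apply: (@Lnorm_le_on _ _ _ mu `[(a - w)%R, (a + w)%R]
  (emodulus (cbump a w)) (2 * w) p) => //.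
- exact: lebesgue_measure_centered (ltW w0).
- move=> x; rewrite /emodulus [modulus _]modulus_real abse_EFin normr_id lee_fin.
  by rewrite ger0_norm ?rbump_ge0 ?rbump_le1.
- move=> x xa; rewrite /emodulus [modulus _]modulus_real rbump_eq0 ?normr0//.
  by move: xa => /in_centered/negP; rewrite -ltNge distrC => /ltW.
Qed.

(** Kept abstract in [B] so that one argument serves both operators. The centers [a1], [a2] are free
    because the norm bounds for the bumps do not depend on them. *)
Lemma not_bounded_Lp (d : nat) (B : (R -> R[i]) -> (R -> R[i]) -> (R -> \bar R))
    (c a1 a2 p1 p2 r : R) :
  (0 < d)%N -> 1 < p1 -> 1 < p2 -> r^-1 = p1^-1 + p2^-1 -> r < (d%:R - 1) / d%:R -> 0 < c ->
  (forall s x, 0 < s -> s <= 1 / 8 -> `|x - 1| <= s / 2 ->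
    ((c * s ^+ d)%:E <=
      `|B (cbump a1 (4 * s ^+ d)) (cbump a2 (4 * s ^+ d)) x|)%E) ->
  ~ bounded_Lp B p1 p2 r.
Proof.
move=> d0 p11 p21 rE rd c0 cB [K HK].
have p10 : 0 < p1 by lra.
have p20 : 0 < p2 by lra.
have r0 : 0 < r by rewrite -invr_gt0 rE addr_gt0 ?invr_gt0.
(* The excess of the exponent d/r over d + 1/r; it is positive exactly when r < (d - 1) / d. *)
pose theta := d%:R * r^-1 - d%:R - r^-1.
have th0 : 0 < theta.
  have -> : theta = (d%:R - 1 - d%:R * r) / r by rewrite /theta; field; rewrite gt_eqF.
  by rewrite divr_gt0// subr_gt0 mulrC -ltr_pdivlMr// ltr0n.
(* Each bump lives on an interval of length 8 s^d, and 1/p1 + 1/p2 = 1/r, whence 8^(1/r). The sign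
   of [K] is unknown, hence |K|. *)
have [s [s0 s8 sc]] := @exists_powR_lt c (`|K| * 8 `^ r^-1) theta c0
  (mulr_ge0 (normr_ge0 _) (powR_ge0 _ _)) th0.
have w0 : 0 < 4 * s ^+ d by rewrite mulr_gt0 ?exprn_gt0.
have mA : mu `[1 - s / 2, 1 + s / 2] = s%:E.
  by rewrite lebesgue_measure_centered ?divr_ge0 ?(ltW s0)//; congr (_%:E); field.
have := HK _ _ (schwartz_cbump a1 _ w0) (schwartz_cbump a2 _ w0).
apply/negP; rewrite -ltNge.
apply: (@lt_le_trans _ _ (c * s ^+ d * s `^ r^-1)%:E); last first.
  apply: (@Lnorm_ge_on _ _ _ mu `[(1 - s / 2)%R, (1 + s / 2)%R]) => //.
  - by rewrite mulr_ge0 ?exprn_ge0 ?ltW.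
  - by move=> x /in_centered; rewrite distrC => x1; exact: cB.
apply: (@le_lt_trans _ _
   (`|K| * (8 * s ^+ d) `^ p1^-1 * (8 * s ^+ d) `^ p2^-1)%:E).
  rewrite !EFinM; apply: (@le_trans _ _ (`|K|%:E *
     'N[mu]_(p1%:E)[emodulus (cbump a1 (4 * s ^+ d))] *
     'N[mu]_(p2%:E)[emodulus (cbump a2 (4 * s ^+ d))])%E).
    rewrite -!muleA lee_wpmul2r ?mule_ge0 ?Lnorm_ge0// lee_fin; exact: ler_norm.
  have e8 : 8 * s ^+ d = 2 * (4 * s ^+ d) by ring.
  rewrite e8 !lee_pmul ?mule_ge0 ?Lnorm_ge0//; exact: Lnorm_cbump_le.
rewrite lte_fin -mulrA -powRD; last first.
  by rewrite gt_eqF// addr_gt0 ?invr_gt0.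
rewrite -rE powRM ?exprn_ge0 ?(ltW s0)//.
have -> : (s ^+ d) `^ r^-1 = s ^+ d * s `^ r^-1 * s `^ theta.
  rewrite -!powR_mulrn ?(ltW s0)// -powRrM -!powRD ?(gt_eqF s0) ?implybT//.
  by congr (_ `^ _); rewrite /theta; ring.
have -> : `|K| * (8 `^ r^-1 * (s ^+ d * s `^ r^-1 * s `^ theta)) =
  (s ^+ d * s `^ r^-1) * (`|K| * 8 `^ r^-1 * s `^ theta) by ring.
have -> : c * s ^+ d * s `^ r^-1 = (s ^+ d * s `^ r^-1) * c by ring.
by rewrite ltr_pM2l// mulr_gt0 ?exprn_gt0 ?powR_gt0.
Qed.

End unboundedness.

(** * Application to the two operators *)

Theorem mainTheorem5 (R : realType) (d : nat) (hd : (2 <= d)%N) :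
  exists P : {poly R},
    [/\ size P = d.+1, P`_0 = 0, P`_1 = 0 &
     forall p1 p2 r : R, 1 < p1 -> 1 < p2 ->
       r^-1 = p1^-1 + p2^-1 -> r < (d%:R - 1) / d%:R ->
       ~ hilbert_bounded P p1 p2 r /\ ~ maximal_bounded P p1 p2 r].
Proof.
exists (flat_poly d); split; [exact: size_flat_poly|exact: flat_poly_coef0|
  exact: flat_poly_coef1|].
move=> p1 p2 r p11 p21 rE rd.
have d0 : (0 < d)%N by exact: ltnW.
(* Each bump is at least exp(-2) within half its radius; the radius 4 s^d makes this half equal to
   the 2 s^d of [flat_poly_near1]. *)
pose c : R := expR (- 2) * expR (- 2).
have c0 : 0 < c by rewrite mulr_gt0 ?expR_gt0.
have small (s : R) : 0 < s -> s <= 1 / 8 -> 0 < s ^+ d <= 1 / 64.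
  move=> s0 s8; rewrite exprn_gt0//=.
  have : s ^+ d <= s ^+ 2 by rewrite ler_wiXn2l//; lra.
  by move/le_trans; apply; rewrite expr2; nra.
have low (s x t : R) : 0 < s -> s <= 1 / 8 -> `|x - 1| <= s / 2 ->
    `|x - t| <= s ^+ d ->
    c <= rbump 0 (4 * s ^+ d) (x - t) *
         rbump d%:R^-1 (4 * s ^+ d) (x - (flat_poly d).[t]).
  move=> s0 s8 x1 xt; have /andP[sd0 _] := small s s0 s8.
  apply: ler_pM; rewrite ?expR_ge0//; apply: rbump_ge.
  - by lra.
  - by rewrite subr0; lra.
  - by lra.
  - by apply: (le_trans (flat_poly_near1 d hd s x t s0 s8 x1 xt)); lra.
split.
  apply: (@not_bounded_Lp _ d _ c 0 d%:R^-1) => // s x s0 s8 x1.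
  have /andP[sd0 sd] := small s s0 s8.
  have /andP[x1l x1r] : 1 - s / 2 <= x <= 1 + s / 2 by rewrite -ler_distl.
  apply: (le_trans _ (lee_abs _)); apply: emodulus_hilbert_ge.
  - exact: ltW.
  - exact: ltW.
  - by lra.
  - by move=> y; rewrite rbump_ge0 rbump_le1.
  - by move=> y; rewrite rbump_ge0 rbump_le1.
  (* Here x >= 15/16 and t <= 1/2, so x - t >= 7/16, beyond the radius 4 s^d <= 1/16. *)
  - move=> t t2; apply: rbump_eq0; first by lra.
    by rewrite subr0; have := ler_norm (x - t); lra.
  - by move=> y y1; apply: rbump_eq0; rewrite ?subr0; lra.
  - by move=> t; exact: low.
apply: (@not_bounded_Lp _ d _ (c / 2) 0 d%:R^-1) => //; first by rewrite divr_gt0.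
move=> s x s0 s8 x1.
have /andP[sd0 sd] := small s s0 s8.
have /andP[x1l x1r] : 1 - s / 2 <= x <= 1 + s / 2 by rewrite -ler_distl.
apply: (le_trans _ (lee_abs _)); rewrite mulrAC; apply: maximal_ge.
- exact: ltW.
- exact: ltW.
- by lra.
- by lra.
- by move=> t; exact: low.
Qed.
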